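(* Let $(M_t)_{t\in[T_0,T_1]}$, $M_t:=\mathbb{E}[X_1\mid\mathcal F_t^I]$, be the one-arc filtered arcade martingale associated with an $X$-randomised arcade process $(I_t^{(1)})_{t\in[T_0,T_1]}$. Then $(M_t)_{t\in[T_0,T_1]}$ is an $(\mathcal F_t^I)$-martingale that interpolates between $X_0$ and $X_1$ almost surely, i.e., $M_{T_0}=X_0$ and $M_{T_1}=X_1$ almost surely.
   Context: Let $0\leqslant T_0<T_1<\infty$. On a probability space $(\Omega,\mathcal F,\mathbb P)$ let $(D_t)_{t\in[T_0,T_1]}$ (the driver) be a real sample-continuous process such that for all $c\in\mathbb{R}$ and $t\in(T_0,T_1)$, $\mathbb P[D_t=c]<1$, and let $X=(X_0,X_1)$ be a random vector independent of $(D_t)$ whose law is a martingale coupling $\pi^X\in\mathcal M(\mu_0,\mu_1)$, where $\mu_0,\mu_1$ are Borel probability measures on $\mathbb{R}$ with finite first moment and in convex order $\mu_0\leqslant_{\mathrm{cx}}\mu_1$; that is, $X_0\sim\mu_0$, $X_1\sim\mu_1$, and $\mathbb{E}[X_1\mid X_0]=X_0$ a.s. Continuous functions $f_0,f_1:[T_0,T_1]\to\mathbb{R}$ are interpolating coefficients if $f_i(T_i)=1$ and $f_i(T_j)=0$ for $i\ne j$. An $X$-randomised arcade process ($X$-RAP) on $\{T_0,T_1\}$ is a process $I_t^{(1)}=D_t-\sum_{i=0}^1(f_i(t)D_{T_i}-g_i(t)X_i)$, where $f_0,f_1$ and $g_0,g_1$ are interpolating coefficients, and $\mathcal F_t^I=\sigma(I^{(1)}_u:T_0\leqslant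 u\leqslant t)$. *)

(* Defs.v *)
From HB Require Import structures.
From mathcomp Require Export all_boot all_order all_algebra.
From mathcomp Require Export all_classical all_reals all_analysis.
Export Order.TTheory GRing.Theory Num.Theory.
Export numFieldNormedType.Exports.

Set Implicit Arguments.
Unset Strict Implicit.
Unset Printing Implicit Defensive.

Local Open Scope classical_set_scope.
Local Open Scope ring_scope.

Section conditioning.
Context {d : measure_display} {T : measurableType d} {R : realType}.

Definition sigma_of {d'} {T' : measurableType d'} (Y : T -> T') :
    set (set T) :=
  preimage_set_system setT Y measurable.

Definition sigma_of_process (J : set R) (Y : R -> T -> R) : set (set T) :=
  <<s \bigcup_(u in J) sigma_of (Y u) >>.

Definition measurable_wrt (G : set (set T)) (Y : T -> R) : Prop :=
  sigma_of Y `<=` G.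

Definition independent (P : probability T R) (G H : set (set T)) : Prop :=
  forall A B, G A -> H B -> P (A `&` B) = (P A * P B)%E.

(* [Y] is a version of E[Z | G]; meant for an integrable [Z] and a
   sigma-algebra [G] contained in the ambient one. *)
Definition is_cond_exp (P : probability T R) (G : set (set T))
    (Z Y : T -> R) : Prop :=
  [/\ measurable_wrt G Y,
      P.-integrable setT (EFin \o Y) &
      forall A, G A -> (\int[P]_(w in A) (Y w)%:E = \int[P]_(w in A) (Z w)%:E)%E].

Definition filtration (J : set R) (F : R -> set (set T)) : Prop :=
  [/\ forall t, J t -> sigma_algebra setT (F t),
      forall t, J t -> F t `<=` measurable &
      forall s t, J s -> J t -> s <= t -> F s `<=` F t].

Definition is_martingale (P : probability T R) (J : set R)
    (F : R -> set (set T)) (M : R -> T -> R) : Prop :=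
  [/\ filtration J F,
      forall t, J t -> measurable_wrt (F t) (M t),
      forall t, J t -> P.-integrable setT (EFin \o M t) &
      forall s t, J s -> J t -> s <= t -> is_cond_exp P (F s) (M t) (M s)].

End conditioning.

Section couplings.
Context {R : realType}.
Implicit Types mu : probability R R.

Definition finite_first_moment mu : Prop :=
  mu.-integrable setT (fun x : R => x%:E).

(* When [mu0] and [mu1] have finite first moment, the negative part of a convex
   function is integrable, so that both sides are well defined in ]-oo, +oo]. *)
Definition convex_order mu0 mu1 : Prop :=
  forall phi : R^o -> R^o, convex_function setT phi ->
    (\int[mu0]_x (phi x)%:E <= \int[mu1]_x (phi x)%:E)%E.

(* Marginals are compared on Borel sets only, since the values of a measure on
   non-measurable sets are unspecified. *)
Definition is_coupling mu0 mu1 (pi : probability (R * R)%type R) : Prop :=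
  (forall A, measurable A -> pi (fst @^-1` A) = mu0 A) /\
  (forall B, measurable B -> pi (snd @^-1` B) = mu1 B).

Definition is_martingale_coupling mu0 mu1
    (pi : probability (R * R)%type R) : Prop :=
  is_coupling mu0 mu1 pi /\ is_cond_exp pi (sigma_of fst) snd fst.

End couplings.

Section arcades.
Context {d : measure_display} {Omega : measurableType d} {R : realType}.
Variables (P : probability Omega R) (T0 T1 : R).

Definition is_driver (D : R -> Omega -> R) : Prop :=
  [/\ forall t, t \in `[T0, T1] -> measurable_fun setT (D t),
      {ae P, forall w, {within `[T0, T1], continuous (fun t => D t w)}} &
      forall c t, t \in `]T0, T1[ -> (P [set w | D t w = c] < 1)%E].

Definition interpolating_coefficients (f0 f1 : R -> R) : Prop :=
  [/\ {within `[T0, T1], continuous f0},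
      {within `[T0, T1], continuous f1},
      f0 T0 = 1 /\ f0 T1 = 0 &
      f1 T1 = 1 /\ f1 T0 = 0].

Definition randomised_arcade (D : R -> Omega -> R) (X : Omega -> R * R)
    (f0 f1 g0 g1 : R -> R) (t : R) (w : Omega) : R :=
  D t w - ((f0 t * D T0 w - g0 t * (X w).1) +
           (f1 t * D T1 w - g1 t * (X w).2)).

Definition arcade_filtration (I : R -> Omega -> R) (t : R) :
    set (set Omega) :=
  sigma_of_process `[T0, t] I.

(* Conditional expectations being defined up to null sets, [M] is an arbitrary
   choice of versions. *)
Definition is_filtered_arcade_martingale (I : R -> Omega -> R)
    (X : Omega -> R * R) (M : R -> Omega -> R) : Prop :=
  forall t, t \in `[T0, T1] ->
    is_cond_exp P (arcade_filtration I t) (fun w => (X w).2) (M t).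

End arcades.

(* Main.v *)
From mathcomp Require Import ring measurable_realfun.
Require Import Defs.

(** The martingale property is that of every closed martingale: all the [M t]
are versions of the conditional expectation of one integrable variable [X_1],
along a filtration, so the defining identity of [M t], tested on an event of an
earlier sigma-algebra [F s], has the same right-hand side as that of [M s]
([closed_martingale]).

The values at the end points come from the coefficients being interpolating:
they remove the driver there and leave [I T0 = X_0] and [I T1 = X_1]
([randomised_arcade_start], [randomised_arcade_end]).
- At [T0] the arcade filtration consists of a single variable, hence is
  [sigma(X_0)]. The law of [X] is a martingale coupling, that is, under that law
  the first coordinate is a version of the conditional expectation of the second
  one given the first. Pulling this back along [X]
  ([cond_exp_comp_distribution]) makes [X_0] a version of
  [E[X_1 | sigma(X_0)]].
- At [T1] the variable [X_1] is itself measurable with respect to the arcade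
  filtration, so it is its own conditional expectation. Its integrability is
  inherited from the second marginal ([coupling_integrable_snd]).

In both cases [M] is another version of the same conditional expectation, and
two versions agree almost surely ([cond_exp_unique]). *)

Set Implicit Arguments.
Unset Strict Implicit.
Unset Printing Implicit Defensive.

Local Open Scope classical_set_scope.
Local Open Scope ring_scope.

Section conditional_expectation.
Context {d : measure_display} {T : measurableType d} {R : realType}.
Variable P : probability T R.

(** Comparing two functions involves both at once, so the set is not a preimage
under either of them; equipping [T] with [G] as its sigma-algebra reduces the
claim to the measurability of the comparison of two real functions. *)
Lemma measurable_wrt_le_set (G : set (set T)) (Y Z : T -> R) :
  sigma_algebra setT G -> measurable_wrt G Y -> measurable_wrt G Z ->
  G [set w | Y w <= Z w].
Proof.
move=> sG mY mZ.
pose TG := g_sigma_algebraType G.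
have GE : (measurable : set (set TG)) = G by exact: sigma_algebra_id.
have mG (V : T -> R) : measurable_wrt G V -> measurable_fun setT (V : TG -> R).
  by move=> mV _ B mB; rewrite GE; apply: mV; exists B.
have mle : measurable_fun setT (fun w : TG => Y w <= Z w).
  exact: measurable_fun_ler (mG _ mY) (mG _ mZ).
have := mle measurableT [set true] Logic.I.
by rewrite setTI GE.
Qed.

(** The set [A] where [Y' <= Y] and its complement both lie in [G], so [Y] and
[Y'] have the same integral over each of them. On each of them [Y - Y'] has
constant sign, hence [|Y - Y'|] has integral zero over the whole space. *)
Lemma cond_exp_unique (G : set (set T)) (Z Y Y' : T -> R) :
  sigma_algebra setT G -> G `<=` measurable ->
  is_cond_exp P G Z Y -> is_cond_exp P G Z Y' ->
  {ae P, forall w, Y w = Y' w}.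
Proof.
move=> sG Gm [mY iY eY] [mY' iY' eY'].
have int_sub A V V' : G A ->
    P.-integrable setT (EFin \o V) -> P.-integrable setT (EFin \o V') ->
    (forall B, G B ->
       \int[P]_(w in B) (V w)%:E = \int[P]_(w in B) (V' w)%:E)%E ->
    (\int[P]_(w in A) (V w - V' w)%:E = 0)%E.
  move=> GA iV iV' eV; have mA := Gm _ GA.
  have iA U : P.-integrable setT (EFin \o U) -> P.-integrable A (EFin \o U).
    by apply: integrableS.
  under eq_integral do rewrite EFinB.
  rewrite integralB_EFin//; [|exact: iA..].
  rewrite (eV _ GA) subee//.
  exact: integrable_fin_num (iA _ iV').
have eYY' A : G A ->
    (\int[P]_(w in A) (Y w)%:E = \int[P]_(w in A) (Y' w)%:E)%E.
  by move=> GA; rewrite eY// eY'.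
pose A := [set w | Y' w <= Y w].
have GA : G A by exact: measurable_wrt_le_set.
have GAc : G (~` A) by case: sG => _ sGC _; rewrite -setTD; exact: sGC.
have mYY' : measurable_fun setT (EFin \o (Y \- Y')).
  have := integrableB measurableT iY iY'.
  by move=> /integrableP[].
have int_abs : (\int[P]_w `|(Y w - Y' w)%:E| = 0)%E.
  rewrite -(setUv A) ge0_integral_setU//; first last.
  - exact/disj_setPCl.
  - by rewrite setUv; exact: measurableT_comp.
  - exact: Gm.
  - exact: Gm.
  rewrite (eq_integral (fun w => (Y w - Y' w)%:E)); last first.
    by move=> w /set_mem Aw; rewrite gee0_abs// lee_fin subr_ge0.
  rewrite int_sub// add0e (eq_integral (fun w => (Y' w - Y w)%:E)); last first.
    move=> w /set_mem /negP; rewrite -ltNge => /ltW Aw.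
    by rewrite lee0_abs -?EFinN ?opprB// lee_fin subr_le0.
  by rewrite int_sub// => B GB; rewrite eYY'.
have /ae_eq_integral_abs : d.-measurable [set: T] by [].
move=> /(_ _ P _ mYY') [/(_ int_abs) + _].
by apply: filterS => w /(_ Logic.I) [] /eqP; rewrite subr_eq0 => /eqP.
Qed.

Lemma cond_exp_self (G : set (set T)) (Z : T -> R) :
  measurable_wrt G Z -> P.-integrable setT (EFin \o Z) ->
  is_cond_exp P G Z Z.
Proof. by []. Qed.

(** An event of [F s] also lies in [F t] for [s <= t], so that both [M s] and
[M t] integrate over it like [Z]. *)
Lemma closed_martingale (J : set R) (F : R -> set (set T)) (Z : T -> R)
    (M : R -> T -> R) :
  filtration J F -> (forall t, J t -> is_cond_exp P (F t) Z (M t)) ->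
  is_martingale P J F M.
Proof.
move=> fF ceM; split => //.
- by move=> t /ceM[].
- by move=> t /ceM[].
- move=> s t Js Jt st; have [mMs iMs eMs] := ceM _ Js.
  split=> // A FsA; rewrite eMs//; have [_ _ ->//] := ceM _ Jt.
  by case: fF => _ _ /(_ s t Js Jt st); exact.
Qed.

End conditional_expectation.

Section change_of_variables.
Context {d d' : measure_display} {T : measurableType d} {T' : measurableType d'}
  {R : realType}.
Variables (P : probability T R) (X : {mfun T >-> T'}).

Lemma integrable_comp_distribution (f : T' -> R) :
  (distribution P X).-integrable setT (EFin \o f) ->
  P.-integrable setT (EFin \o (f \o X)).
Proof.
move=> /integrableP[mf foo]; apply/integrableP; split.
  by apply: (measurableT_comp mf).
move: foo; rewrite ge0_integral_pushforward//; exact: measurableT_comp.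
Qed.

(** Conditional expectations given a function [h] depend on the joint law only:
an event of [sigma(h o X)] is the preimage under [X] of an event of [sigma(h)],
and the change of variables along [X] turns one defining identity into the
other. This moves the martingale property of a coupling, which speaks of the
coordinates of the plane, to the random vector having this law. *)
Lemma cond_exp_comp_distribution d'' (U : measurableType d'') (h : T' -> U)
    (f g : T' -> R) :
  measurable_fun setT h -> (distribution P X).-integrable setT (EFin \o f) ->
  is_cond_exp (distribution P X) (sigma_of h) f g ->
  is_cond_exp P (sigma_of (h \o X)) (f \o X) (g \o X).
Proof.
move=> mh if_ [mg ig eg]; split.
- move=> _ [B mB <-]; have [C mC hC] : sigma_of h (setT `&` g @^-1` B).
    by apply: mg; exists B.
  exists C => //; rewrite !setTI in hC *.
  exact: (congr1 (fun A => X @^-1` A) hC).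
- exact: integrable_comp_distribution.
- move=> _ [C mC <-].
  have mhC : measurable (h @^-1` C) by rewrite -[_ @^-1` _]setTI; exact: mh.
  have change v : (distribution P X).-integrable setT (EFin \o v) ->
      (\int[distribution P X]_(x in h @^-1` C) (v x)%:E =
       \int[P]_(w in X @^-1` (h @^-1` C)) (v (X w))%:E)%E.
    move=> iv; rewrite integral_pushforward//.
      by case/integrableP: iv.
    have mXhC : measurable (X @^-1` (h @^-1` C)) by exact: measurable_funPTI.
    apply: (integrableS measurableT mXhC) => //.
    exact: integrable_comp_distribution iv.
  rewrite setTI comp_preimage -!change//.
  by apply: eg; exists C => //; rewrite setTI.
Qed.

End change_of_variables.

Section natural_filtration.
Context {d : measure_display} {T : measurableType d} {R : realType}.

Lemma sigma_of_process1 (t : R) (Y : R -> T -> R) :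
  sigma_of_process [set t] Y = sigma_of (Y t).
Proof.
rewrite /sigma_of_process bigcup_set1; apply: sigma_algebra_id.
by apply: sigma_algebra_preimage; exact: sigma_algebra_measurable.
Qed.

Lemma sigma_of_process_measurable_wrt (J : set R) (Y : R -> T -> R) t :
  J t -> measurable_wrt (sigma_of_process J Y) (Y t).
Proof. by move=> Jt A YA; apply: sub_sigma_algebra; exists t. Qed.

Lemma natural_filtration (T0 T1 : R) (Y : R -> T -> R) :
  (forall t, t \in `[T0, T1] -> measurable_fun setT (Y t)) ->
  filtration `[T0, T1] (arcade_filtration T0 Y).
Proof.
move=> mY; split=> [t _|t|s t _ _ st].
- exact: smallest_sigma_algebra.
- rewrite /= in_itv/= => /andP[_ tT1].
  apply: smallest_sub; first exact: sigma_algebra_measurable.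
  move=> A [u /=]; rewrite in_itv/= => /andP[T0u ut] [B mB <-].
  by apply: mY => //; rewrite in_itv/= T0u (le_trans ut).
- apply: sub_sigma_algebra2 => A [u /=]; rewrite in_itv/= => /andP[T0u us] YA.
  by exists u => //=; rewrite in_itv/= T0u (le_trans us).
Qed.

End natural_filtration.

Section couplings.
Context {R : realType}.

Lemma coupling_integrable_snd (mu0 mu1 : probability R R)
    (pi : probability (R * R)%type R) :
  is_coupling mu0 mu1 pi -> finite_first_moment mu1 ->
  pi.-integrable setT (EFin \o snd).
Proof.
move=> [_ pi1] /integrableP[mid fin]; apply/integrableP; split.
  exact: measurableT_comp.
move: fin; rewrite (eq_measure_integral (pushforward pi snd)); last first.
  by move=> B mB _; apply/esym; exact: pi1.
by rewrite ge0_integral_pushforward//; exact: measurableT_comp.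
Qed.

End couplings.

Section arcade.
Context {d : measure_display} {Omega : measurableType d} {R : realType}.
Variables (T0 T1 : R) (D : R -> Omega -> R) (X : Omega -> R * R).
Variables (f0 f1 g0 g1 : R -> R).
Hypothesis hf : interpolating_coefficients T0 T1 f0 f1.
Hypothesis hg : interpolating_coefficients T0 T1 g0 g1.

Lemma randomised_arcade_start :
  randomised_arcade T0 T1 D X f0 f1 g0 g1 T0 = fst \o X.
Proof.
apply/funext => w; case: hf hg => _ _ [f00 _] [_ f10] [_ _ [g00 _] [_ g10]].
by rewrite /randomised_arcade f00 f10 g00 g10 /=; ring.
Qed.

Lemma randomised_arcade_end :
  randomised_arcade T0 T1 D X f0 f1 g0 g1 T1 = snd \o X.
Proof.
apply/funext => w; case: hf hg => _ _ [_ f01] [f11 _] [_ _ [_ g01] [g11 _]].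
by rewrite /randomised_arcade f01 f11 g01 g11 /=; ring.
Qed.

Lemma measurable_randomised_arcade t :
  T0 <= T1 -> (forall u, u \in `[T0, T1] -> measurable_fun setT (D u)) ->
  measurable_fun setT X -> t \in `[T0, T1] ->
  measurable_fun setT (randomised_arcade T0 T1 D X f0 f1 g0 g1 t).
Proof.
move=> T01 mD mX tT.
have mX1 : measurable_fun setT (fst \o X) by exact: measurableT_comp.
have mX2 : measurable_fun setT (snd \o X) by exact: measurableT_comp.
have mZ c (V : Omega -> R) : measurable_fun setT V ->
    measurable_fun setT (fun w => c * V w) by exact: measurable_funM.
apply: measurable_funB; first exact: mD.
apply: measurable_funD; apply: measurable_funB; apply: mZ => //.
- by apply: mD; rewrite in_itv/= lexx.
- by apply: mD; rewrite in_itv/= lexx T01.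
Qed.

End arcade.

Theorem proposition5p2 (d : measure_display) (Omega : measurableType d)
    (R : realType) (P : probability Omega R)
    (T0 T1 : R) (hT0 : 0 <= T0) (hT01 : T0 < T1)
    (D : R -> Omega -> R) (hD : is_driver P T0 T1 D)
    (mu0 mu1 : probability R R)
    (hmu0 : finite_first_moment mu0) (hmu1 : finite_first_moment mu1)
    (hmu01 : convex_order mu0 mu1)
    (X : {RV P >-> (R * R)%type})
    (hXD : independent P (sigma_of X) (sigma_of_process `[T0, T1] D))
    (hX : is_martingale_coupling mu0 mu1 (distribution P X))
    (f0 f1 g0 g1 : R -> R)
    (hf : interpolating_coefficients T0 T1 f0 f1)
    (hg : interpolating_coefficients T0 T1 g0 g1)
    (I : R -> Omega -> R)
    (hI : forall t, t \in `[T0, T1] ->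
       forall w, I t w = randomised_arcade T0 T1 D X f0 f1 g0 g1 t w)
    (M : R -> Omega -> R)
    (hM : is_filtered_arcade_martingale P T0 T1 I X M) :
  [/\ is_martingale P `[T0, T1] (arcade_filtration T0 I) M,
      {ae P, forall w, M T0 w = (X w).1} &
      {ae P, forall w, M T1 w = (X w).2}].
Proof.
have T0in : T0 \in `[T0, T1] by rewrite in_itv/= lexx ltW.
have T1in : T1 \in `[T0, T1] by rewrite in_itv/= lexx ltW.
have IE t : t \in `[T0, T1] -> I t = randomised_arcade T0 T1 D X f0 f1 g0 g1 t.
  by move=> tT; apply/funext => w; exact: hI.
have IT0 : I T0 = fst \o X by rewrite IE// randomised_arcade_start.
have IT1 : I T1 = snd \o X by rewrite IE// randomised_arcade_end.
have FI : filtration `[T0, T1] (arcade_filtration T0 I).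
  apply: natural_filtration => t tT; rewrite IE//.
  by apply: measurable_randomised_arcade => //; [exact: ltW | case: hD].
have [sF Fm _] := FI.
have [cpl ceX] := hX.
have isnd := coupling_integrable_snd cpl hmu1.
split.
- exact: closed_martingale hM.
- have FT0 : arcade_filtration T0 I T0 = sigma_of (fst \o X).
    by rewrite /arcade_filtration set_itv1 sigma_of_process1 IT0.
  have ceX0 : is_cond_exp P (arcade_filtration T0 I T0) (snd \o X) (fst \o X).
    rewrite FT0; apply: cond_exp_comp_distribution isnd ceX.
    exact: measurable_fst.
  exact: cond_exp_unique (sF _ T0in) (Fm _ T0in) (hM _ T0in) ceX0.
- have ceX1 : is_cond_exp P (arcade_filtration T0 I T1) (snd \o X) (snd \o X).
    apply: cond_exp_self; last exact: integrable_comp_distribution isnd.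
    rewrite -[X in measurable_wrt _ X]IT1.
    by apply: sigma_of_process_measurable_wrt; rewrite /= in_itv/= lexx ltW.
  exact: cond_exp_unique (sF _ T1in) (Fm _ T1in) (hM _ T1in) ceX1.
Qed.
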